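(* Fix integers $d,m,n\geq 2$, a proper divisor $\ell\geq1$ of $n$, and a $d$-th root of unity $\zeta\neq1$. Define $C_{d,m,\ell}=d^{\ell}\big(\prod_{i=0}^{\ell-1}a_{m-1+i}\big)^{d-1}\in\mathbb{Z}[c]$. Then for every integer $j\geq1$, $$b_{j+1}\equiv \zeta^{d-1}C_{d,m,\ell}\,b_j+1\pmod{I},$$ where $I=\langle B_1\rangle$ is the principal ideal of $\mathbb{Z}[\zeta,c]$ generated by $B_1=a_{m+\ell-1}-\zeta a_{m-1}$. In particular, for any root $\alpha_0$ of $B_1$, $b_{j+1}(\alpha_0)=\zeta^{d-1}C_{d,m,\ell}(\alpha_0)b_j(\alpha_0)+1$.
   Context: For an integer $d\geq 2$ define polynomials $a_i\in\mathbb{Z}[c]$ by $a_1=c$, $a_{i+1}=a_i^d+c$, with $a_0=0$. For the fixed $m,\ell,\zeta$, set $B_j=a_{m+\ell j-1}-\zeta a_{m-1}\in\mathbb{Z}[\zeta,c]$ for $j\geq1$ and $b_j=B_j/B_1$; each $b_j$ is a polynomial in $\mathbb{Z}[\zeta,c]$. *)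

(* Defs.v *)
From HB Require Import structures.
From mathcomp Require Import all_boot all_order all_algebra.

Set Implicit Arguments.
Unset Strict Implicit.
Unset Printing Implicit Defensive.

Import GRing.Theory Num.Theory.
Local Open Scope ring_scope.

(* The variable 'X of the univariate polynomials below is the parameter c. *)

Fixpoint apoly (d i : nat) : {poly int} :=
  if i is k.+1 then apoly d k ^+ d + 'X else 0.

Definition Cpoly (d m l : nat) : {poly int} :=
  (d%:R ^+ l) * (\prod_(i < l) apoly d (m - 1 + i)) ^+ (d - 1).

Section OverC.
Variable C : numClosedFieldType.

Definition toC (p : {poly int}) : {poly C} := map_poly intr p.

(* Z[z,c], viewed inside C[c], is the image of Z[t][c] under t |-> z. *)
Definition evalZ (z : C) (P : {poly {poly int}}) : {poly C} :=
  map_poly (horner_eval z \o map_poly intr) P.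

Definition in_Zzc (z : C) (p : {poly C}) : Prop := exists P, p = evalZ z P.

(* Congruence of p and q modulo the principal ideal of Z[z,c] generated
   by g; the cofactor is required to lie in Z[z,c], not merely in C[c]. *)
Definition congr_Zzc (z : C) (g p q : {poly C}) : Prop :=
  exists2 r, in_Zzc z r & p - q = r * g.

Definition Bpoly (d m l : nat) (z : C) (j : nat) : {poly C} :=
  toC (apoly d (m + l * j - 1)) - z *: toC (apoly d (m - 1)).

(* The quotient is taken in C[c]. It is exact (bpolyK) and it lies in
   Z[z,c] (bpoly_in_Zzc). *)
Definition bpoly (d m l : nat) (z : C) (j : nat) : {poly C} :=
  Bpoly d m l z j %/ Bpoly d m l z 1.

Section Facts.
Variables (d m l : nat) (z : C).
Hypotheses (d_ge2 : (2 <= d)%N) (m_ge2 : (2 <= m)%N) (l_ge1 : (1 <= l)%N).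
Hypotheses (zd1 : z ^+ d = 1) (z_neq1 : z != 1).

Let B := Bpoly d m l z.

Lemma toC_aS i : toC (apoly d i.+1) = toC (apoly d i) ^+ d + 'X.
Proof. by rewrite /toC /= rmorphD rmorphXn /= map_polyX. Qed.

Lemma coef_apoly i : (apoly d i)`_0 = 0 /\ (apoly d i.+1)`_1 = 1.
Proof.
have e0 k : (apoly d k)`_0 = 0.
  elim: k => [|k IH]; first by rewrite coef0.
  rewrite /= coefD coefX addr0 -horner_coef0 horner_exp horner_coef0 IH.
  by rewrite expr0n; case: (d) d_ge2.
split=> //=; rewrite coefD coefX.
have /eqP/(@factor_theorem _ (apoly d i) 0) [q ->] : (apoly d i).[0] = 0.
  by rewrite horner_coef0.
rewrite subr0 exprMn -(subnK d_ge2) [('X) ^+ _]exprD mulrA coefMXn /=.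
by rewrite add0r.
Qed.

Lemma Bpoly1_neq0 : B 1 != 0.
Proof.
apply/eqP=> /(congr1 (fun p : {poly C} => p`_1)).
rewrite /B /Bpoly muln1 coef0 coefB coefZ !coef_map /=.
have -> : (m + l - 1 = (m + l - 2).+1)%N by rewrite -!subSn // ltn_addr.
have -> : (m - 1 = (m - 2).+1)%N by rewrite -subSn.
rewrite !(proj2 (coef_apoly _)) mulr1 => /eqP.
by rewrite subr_eq0 eq_sym (negPf z_neq1).
Qed.

Lemma in_Zzc_evalZ P : in_Zzc z (evalZ z P). Proof. by exists P. Qed.

Lemma in_Zzc_toC p : in_Zzc z (toC p).
Proof.
exists (map_poly polyC p); rewrite /evalZ /toC -map_poly_comp.
apply: eq_map_poly => x /=.
by rewrite map_polyC /= /horner_eval hornerC.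
Qed.

Lemma in_ZzcZ p : in_Zzc z p -> in_Zzc z (z *: p).
Proof.
move=> [P ->]; exists ('X *: P); rewrite /evalZ map_polyZ /=.
by rewrite map_polyX /horner_eval hornerX.
Qed.

Lemma in_ZzcB p q : in_Zzc z p -> in_Zzc z q -> in_Zzc z (p - q).
Proof. by move=> [P ->] [Q ->]; exists (P - Q); rewrite /evalZ rmorphB. Qed.

Lemma in_ZzcM p q : in_Zzc z p -> in_Zzc z q -> in_Zzc z (p * q).
Proof. by move=> [P ->] [Q ->]; exists (P * Q); rewrite /evalZ rmorphM. Qed.

Lemma in_ZzcD p q : in_Zzc z p -> in_Zzc z q -> in_Zzc z (p + q).
Proof. by move=> [P ->] [Q ->]; exists (P + Q); rewrite /evalZ rmorphD. Qed.

Lemma in_ZzcX p k : in_Zzc z p -> in_Zzc z (p ^+ k).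
Proof. by move=> [P ->]; exists (P ^+ k); rewrite /evalZ rmorphXn. Qed.

Lemma congr_ZzcXn g p q k : in_Zzc z p -> in_Zzc z q ->
  congr_Zzc z g p q -> congr_Zzc z g (p ^+ k) (q ^+ k).
Proof.
move=> Zp Zq [r Zr e].
elim: k => [|k [s Zs IH]].
  by exists (toC 0); [exact: in_Zzc_toC | rewrite /toC rmorph0 mul0r subrr].
exists (r * p ^+ k + q * s).
  by apply: in_ZzcD; apply: in_ZzcM => //; apply: in_ZzcX.
rewrite mulrDl mulrAC -e -[q * s * g]mulrA -IH !exprS mulrBl mulrBr.
by rewrite addrA subrK.
Qed.

Lemma congr_Zzc_trans g p q r :
  congr_Zzc z g p q -> congr_Zzc z g q r -> congr_Zzc z g p r.
Proof.
move=> [s Zs e] [t Zt f]; exists (s + t); first exact: in_ZzcD.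
by rewrite mulrDl -e -f addrA subrK.
Qed.

Lemma congr_orbit k :
  congr_Zzc z (B 1) (toC (apoly d (m + l + k))) (toC (apoly d (m + k))).
Proof.
elim: k => [|k [r Zr e]]; last first.
  rewrite !addnS !toC_aS.
  have [s Zs f] : congr_Zzc z (B 1) (toC (apoly d (m + l + k)) ^+ d)
      (toC (apoly d (m + k)) ^+ d).
    by apply: congr_ZzcXn; [exact: in_Zzc_toC | exact: in_Zzc_toC | exists r].
  by exists s => //; rewrite opprD addrACA subrr addr0.
rewrite !addn0.
have -> : (m + l = (m + l - 1).+1)%N by rewrite subn1 prednK // addn_gt0 ltnW.
have -> : (apoly d m = apoly d (m - 1).+1) by rewrite subn1 prednK // ltnW.
rewrite !toC_aS.
have [||| s Zs f] := @congr_ZzcXn (B 1) (toC (apoly d (m + l - 1)))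
  (z *: toC (apoly d (m - 1))) d.
- exact: in_Zzc_toC.
- by apply: in_ZzcZ; apply: in_Zzc_toC.
- exists (toC 1); first exact: in_Zzc_toC.
  by rewrite /B /Bpoly muln1 /toC rmorph1 mul1r.
exists s => //; rewrite -f exprZn zd1 scale1r.
by rewrite opprD addrACA subrr addr0.
Qed.

Lemma Bpoly_multiple j : (1 <= j)%N ->
  exists2 q, in_Zzc z q & B j = q * B 1.
Proof.
case: j => // j _; elim: j => [|j [q Zq e]].
  by exists (toC 1); [exact: in_Zzc_toC | rewrite /toC rmorph1 mul1r].
have [r Zr f] := congr_orbit (l * j.+1 - 1).
have g : (0 < l * j.+1)%N by rewrite muln_gt0 l_ge1.
exists (r + q); first exact: in_ZzcD.
rewrite mulrDl -e -f /B /Bpoly !addnBA //.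
by rewrite [(l * j.+2)%N]mulnS addnA addrA subrK.
Qed.

Lemma bpolyK j : (1 <= j)%N -> bpoly d m l z j * B 1 = B j.
Proof.
case/Bpoly_multiple=> q _; rewrite /bpoly -/(B _) => ->.
by rewrite mulpK // Bpoly1_neq0.
Qed.

Lemma bpoly_in_Zzc j : (1 <= j)%N -> in_Zzc z (bpoly d m l z j).
Proof.
case/Bpoly_multiple=> q Zq; rewrite /bpoly -/(B _) => ->.
by rewrite mulpK // Bpoly1_neq0.
Qed.

End Facts.
End OverC.

(* Main.v *)
(** Write [f x = x ^+ d + c], so that [a_(i+k)] is the [k]-th iterate of [f] at
    [a_i]. The second-order Taylor formula for the [l]-th iterate of [f] at
    [z a_(m-1)] with increment [B_j] reads
    [a_(m+l(j+1)-1) = a_(m+l-1) + z ^+ (d - 1) C B_j + s B_j ^+ 2]: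
    as [z ^+ d = 1], the orbit of [z a_(m-1)] leaves that of [a_(m-1)] only at
    its starting point, whence the factor [z ^+ (d - 1)] in the derivative. The
    left-hand side minus [a_(m+l-1)] is [B_(j+1) - B_1], and [B_j = b_j B_1], so
    it remains to divide by [B_1]. *)

Require Import Defs.
From HB Require Import structures.
From mathcomp Require Import all_boot all_order all_algebra.
From mathcomp Require Import ring zify.

Set Implicit Arguments.
Unset Strict Implicit.
Unset Printing Implicit Defensive.

Import GRing.Theory.
Local Open Scope ring_scope.

Lemma horner_taylor2 (R : comNzRingType) (p : {poly R}) (x u : R) :
  exists s, p.[x + u] = p.[x] + p^`().[x] * u + s * u ^+ 2.
Proof.
exists (\sum_(i < size p) p^`N(i.+2).[x] * u ^+ i).
have size_le : (size p <= (size p).+2)%N by exact/leqW/leqnSn.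
rewrite (nderiv_taylor_wide (mulrC x u) size_le).
rewrite !big_ord_recl nderivn0 nderivn1 expr0 mulr1 expr1 addrA mulr_suml.
by congr (_ + _); apply: eq_bigr => i _; rewrite -mulrA -exprD addn2.
Qed.

Definition multiplier (R : nzRingType) (p : {poly R}) (x : R) (k : nat) : R :=
  \prod_(i < k) p^`().[iter i (horner p) x].

Lemma multiplierS (R : nzRingType) (p : {poly R}) (x : R) k :
  multiplier p x k.+1 = multiplier p x k * p^`().[iter k (horner p) x].
Proof. exact: big_ord_recr. Qed.

Lemma iter_horner_taylor2 (R : comNzRingType) (p : {poly R}) (x u : R) k :
  exists s, iter k (horner p) (x + u) =
    iter k (horner p) x + multiplier p x k * u + s * u ^+ 2.
Proof.
elim: k => [|k [s IH]].
  by exists 0; rewrite /multiplier big_ord0 mul1r mul0r addr0.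
rewrite multiplierS !iterS IH -addrA.
set y := iter k _ x; set lambda := multiplier p x k.
have [t ->] := horner_taylor2 p y (lambda * u + s * u ^+ 2).
by exists (p^`().[y] * s + t * (lambda + s * u) ^+ 2); ring.
Qed.

Section IterateMap.
Variables (R S : nzRingType) (phi : {rmorphism R -> S}) (p : {poly R}).

Lemma iter_horner_map x k :
  iter k (horner (map_poly phi p)) (phi x) = phi (iter k (horner p) x).
Proof. by elim: k => //= k ->; rewrite horner_map. Qed.

Lemma multiplier_map x k :
  multiplier (map_poly phi p) (phi x) k = phi (multiplier p x k).
Proof.
rewrite /multiplier rmorph_prod; apply: eq_bigr => i _.
by rewrite deriv_map iter_horner_map horner_map.
Qed.

End IterateMap.

Definition unicritical (R : nzRingType) (d : nat) (c : R) : {poly R} :=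
  'X^d + c%:P.

Lemma map_unicritical (R S : nzRingType) (phi : {rmorphism R -> S}) d c :
  map_poly phi (unicritical d c) = unicritical d (phi c).
Proof. by rewrite rmorphD /= map_polyXn map_polyC. Qed.

Section Unicritical.
Variables (R : comNzRingType) (d : nat) (c : R).
Implicit Types x z : R.

Let f : {poly R} := unicritical d c.

Lemma horner_unicritical x : f.[x] = x ^+ d + c.
Proof. by rewrite !hornerE. Qed.

Lemma horner_deriv_unicritical x : f^`().[x] = d%:R * x ^+ (d - 1).
Proof.
by rewrite derivD derivC addr0 derivXn hornerMn hornerXn subn1 mulr_natl.
Qed.

Lemma iter_unicritical_unityM z x k : (0 < k)%N -> z ^+ d = 1 ->
  iter k (horner f) (z * x) = iter k (horner f) x.
Proof.
case: k => // k _ zd1.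
by rewrite !iterSr !horner_unicritical exprMn zd1 mul1r.
Qed.

Lemma multiplier_unicritical_unityM z x k : (0 < k)%N -> z ^+ d = 1 ->
  multiplier f (z * x) k = z ^+ (d - 1) * multiplier f x k.
Proof.
case: k => // k _ zd1; rewrite /multiplier !big_ord_recl mulrA; congr (_ * _).
  by rewrite !horner_deriv_unicritical exprMn mulrCA.
by apply: eq_bigr => i _; rewrite iter_unicritical_unityM.
Qed.

End Unicritical.

Lemma apolyD d n k :
  apoly d (n + k) = iter k (horner (unicritical d 'X)) (apoly d n).
Proof.
elim: k => [|k IH]; first by rewrite addn0.
by rewrite addnS iterS -IH horner_unicritical.
Qed.

Lemma CpolyE d m k :
  Cpoly d m k = multiplier (unicritical d 'X) (apoly d (m - 1)) k.
Proof.
under [RHS]eq_bigr => i _ do rewrite horner_deriv_unicritical -apolyD.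
by rewrite big_split /= prodr_const card_ord prodrXl.
Qed.

Section ComplexCoefficients.
Variable C : numClosedFieldType.
Implicit Types (z : C) (p q g x u : {poly C}).

HB.instance Definition _ := GRing.RMorphism.copy (@toC C) (map_poly intr).
HB.instance Definition _ z := GRing.RMorphism.copy (evalZ z)
  (map_poly (horner_eval z \o map_poly intr)).

Lemma toC_X : toC C 'X = 'X. Proof. exact: map_polyX. Qed.

Lemma evalZ_X z : evalZ z 'X = 'X. Proof. exact: map_polyX. Qed.

Lemma toC_apolyD d n k : toC C (apoly d (n + k)) =
  iter k (horner (unicritical d 'X)) (toC C (apoly d n)).
Proof. by rewrite apolyD -iter_horner_map map_unicritical /= toC_X. Qed.

Lemma toC_CpolyE d m k : toC C (Cpoly d m k) =
  multiplier (unicritical d 'X) (toC C (apoly d (m - 1))) k.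
Proof. by rewrite CpolyE -multiplier_map map_unicritical /= toC_X. Qed.

(* The Taylor formula is taken in Z[t][c], before specializing t to z, which
   puts its remainder coefficient in Z[z,c]. *)
Lemma in_Zzc_iter_unicritical_taylor2 z d x u k (f := unicritical d 'X) :
    in_Zzc z x -> in_Zzc z u ->
  exists2 s, in_Zzc z s & iter k (horner f) (x + u) =
    iter k (horner f) x + multiplier f x k * u + s * u ^+ 2.
Proof.
move=> [X ->] [U ->].
have [S taylorS] := iter_horner_taylor2 (unicritical d 'X) X U k.
exists (evalZ z S); first exact: in_Zzc_evalZ.
have -> : f = map_poly (evalZ z) (unicritical d 'X).
  by rewrite map_unicritical /= evalZ_X.
rewrite -rmorphD !iter_horner_map multiplier_map taylorS.
by rewrite !(rmorphD, rmorphM, rmorphXn).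
Qed.

Lemma congr_Zzc_root z g p q a :
  congr_Zzc z g p q -> root g a -> p.[a] = q.[a].
Proof.
case=> r _ pBq /eqP ga0; apply/eqP.
by rewrite -subr_eq0 -hornerN -hornerD pBq hornerM ga0 mulr0.
Qed.

Section Recurrence.
Variables (d m l : nat) (z : C).
Hypotheses (l_gt0 : (0 < l)%N) (zd1 : z ^+ d = 1).

Let B := Bpoly d m l z.
Let b := bpoly d m l z.
Let mu := z ^+ (d - 1) *: toC C (Cpoly d m l).

Lemma BpolyS_taylor2 j : (0 < m)%N ->
  exists2 s, in_Zzc z s & B j.+1 = B 1 + mu * B j + s * B j ^+ 2.
Proof.
move=> m_gt0; pose a i := toC C (apoly d i).
pose f := unicritical d ('X : {poly C}).
have Za : in_Zzc z (z *: a (m - 1)%N) by exact/in_ZzcZ/in_Zzc_toC.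
have ZB : in_Zzc z (B j) by exact: in_ZzcB (in_Zzc_toC _ _) Za.
have zPd1 : z%:P ^+ d = 1 :> {poly C} by rewrite -rmorphXn zd1.
have iter_f i : iter l (horner f) (a i) = a (i + l)%N by rewrite /a toC_apolyD.
have iter_f_za : iter l (horner f) (z *: a (m - 1)%N) = a (m + l * 1 - 1)%N.
  rewrite -mul_polyC iter_unicritical_unityM // iter_f.
  by congr (a _); lia.
have iter_f_zaDB :
    iter l (horner f) (z *: a (m - 1)%N + B j) = a (m + l * j.+1 - 1)%N.
  by rewrite /B /Bpoly addrC subrK iter_f; congr (a _); lia.
have multiplier_za : multiplier f (z *: a (m - 1)%N) l = mu.
  rewrite -mul_polyC multiplier_unicritical_unityM // -toC_CpolyE.
  by rewrite -rmorphXn mul_polyC.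
have [s Zs taylor_s] := in_Zzc_iter_unicritical_taylor2 d l Za ZB.
exists s => //; move: taylor_s.
rewrite iter_f_zaDB iter_f_za multiplier_za => a_rec.
have BE i : B i = a (m + l * i - 1)%N - z *: a (m - 1)%N by [].
by rewrite [B j.+1]BE [B 1]BE a_rec addrAC [X in X + _]addrAC.
Qed.

Lemma congr_Zzc_bpolyS j :
    (2 <= d)%N -> (2 <= m)%N -> z != 1 -> (1 <= j)%N ->
  congr_Zzc z (B 1) (b j.+1) (mu * b j + 1).
Proof.
move=> d_ge2 m_ge2 z_neq1 j_ge1.
have [s Zs B_rec] := BpolyS_taylor2 j (ltnW m_ge2).
have bK i : (1 <= i)%N -> b i * B 1 = B i by exact: bpolyK.
exists (s * b j ^+ 2).
  by apply: in_ZzcM => //; apply/in_ZzcX/bpoly_in_Zzc.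
have B1_neq0 : B 1 != 0 by exact: Bpoly1_neq0.
by apply: (mulIf B1_neq0); rewrite mulrBl bK // B_rec -[B j]bK //; ring.
Qed.

End Recurrence.
End ComplexCoefficients.

Theorem theorem4p1 (C : numClosedFieldType) (d m n l : nat) (z : C)
    (hd : (2 <= d)%N) (hm : (2 <= m)%N) (hn : (2 <= n)%N)
    (hl : (1 <= l)%N) (hln : (l %| n)%N) (hlt : (l < n)%N)
    (hz : z ^+ d = 1) (hz1 : z <> 1) :
  (forall j : nat, (1 <= j)%N ->
     congr_Zzc z (Bpoly d m l z 1)
       (bpoly d m l z j.+1)
       (z ^+ (d - 1) *: (toC C (Cpoly d m l) * bpoly d m l z j) + 1))
  /\
  (forall j : nat, (1 <= j)%N ->
   forall alpha0 : C, root (Bpoly d m l z 1) alpha0 ->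
     (bpoly d m l z j.+1).[alpha0] =
       z ^+ (d - 1) * (toC C (Cpoly d m l)).[alpha0]
         * (bpoly d m l z j).[alpha0] + 1).
Proof.
move/eqP: hz1 => z_neq1.
have rec j : (1 <= j)%N -> congr_Zzc z (Bpoly d m l z 1) (bpoly d m l z j.+1)
    (z ^+ (d - 1) *: (toC C (Cpoly d m l) * bpoly d m l z j) + 1).
  by rewrite scalerAl; apply: congr_Zzc_bpolyS.
split=> // j j_ge1 alpha0 root_alpha0.
rewrite (congr_Zzc_root (rec j j_ge1) root_alpha0).
by rewrite hornerD hornerZ hornerM hornerC mulrA.
Qed.
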